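(* Let $a > b > 0$ be real numbers and let $A$ be a complex $n \times n$ matrix whose spectrum belongs to $$\mathcal{E}_i = \left\{\lambda \in \mathbb{C} : \frac{(\mathrm{Re}\,\lambda)^2}{a^2} + \frac{(\mathrm{Im}\,\lambda)^2}{b^2} < 1 \right\}.$$ Let $H = H^* > 0$ be a solution to $$H - \left(\frac{1}{2a^2}+\frac{1}{2b^2}\right) A^*HA - \left(\frac{1}{4a^2}-\frac{1}{4b^2}\right)\left(HA^2+(A^* )^2H\right) = I.$$ If $B$ is a complex $n \times n$ matrix such that $$\|B\| < \sqrt{\|A\|^2 + \frac{b^2}{\|H\|}} - \|A\|,$$ then the spectrum of the matrix $A + B$ also belongs to $\mathcal{E}_i$.
   Context: $M^*$ denotes the conjugate transpose of $M$, and $I$ is the $n\times n$ identity matrix. For a Hermitian matrix $M$, $M > 0$ means that $M$ is positive definite. $\|\cdot\|$ is the spectral norm of matrices, i.e. the operator norm induced by the Euclidean norm on $\mathbb{C}^n$. *)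

(* Defs.v *)
From mathcomp Require Import all_boot all_order all_algebra.
From mathcomp Require Import boolp classical_sets reals complex.

Set Implicit Arguments.
Unset Strict Implicit.
Unset Printing Implicit Defensive.

Import Order.TTheory GRing.Theory Num.Theory.

Local Open Scope classical_set_scope.
Local Open Scope ring_scope.
Local Open Scope complex_scope.
Local Open Scope sesquilinear_scope.

Definition ellipse_interior (R : realType) (a b : R) : set R[i] :=
  [set z | complex.Re z ^+ 2 / a ^+ 2 + complex.Im z ^+ 2 / b ^+ 2 < 1].

(* [eigenvalue] refers to row eigenvectors; a square matrix has the same
   eigenvalues on rows and on columns. *)
Definition spectrum (R : realType) (n : nat) (M : 'M[R[i]]_n) : set R[i] :=
  [set z | eigenvalue M z].

(* In the order of R[i], 0 < z means that z is real and positive. *)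
Definition posdefmx (R : realType) (n : nat) (M : 'M[R[i]]_n) : Prop :=
  M \is hermsymmx /\
  forall x : 'cV[R[i]]_n, x != 0 -> 0 < (x ^t* *m M *m x) 0 0.

Definition euclidean_norm (R : realType) (n : nat) (x : 'cV[R[i]]_n) : R :=
  Num.sqrt (\sum_(i < n) (complex.Re (x i 0) ^+ 2 + complex.Im (x i 0) ^+ 2)).

(* Taking the supremum over the closed unit ball, rather than the unit sphere,
   keeps the set nonempty when n = 0. *)
Definition spectral_norm (R : realType) (n : nat) (M : 'M[R[i]]_n) : R :=
  sup [set euclidean_norm (M *m x) | x in
         [set x : 'cV[R[i]]_n | euclidean_norm x <= 1]].

(* Main.v *)
(* Write M' for the conjugate transpose of M, p = 1/(2a^2) + 1/(2b^2),
   r = 1/(4a^2) - 1/(4b^2) < 0 and L(M) = H - p M'HM - r (HM^2 + M'^2 H), so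
   that L(A) = 1. If (A + B)x = zx with |x| = 1, then
     x' L(A + B) x = (x'Hx) (1 - (Re z)^2/a^2 - (Im z)^2/b^2),
   so it suffices that x' L(A + B) x > 0. Since p - 2r = 1/b^2, Cauchy-Schwarz
   bounds the perturbation |x' (L(A + B) - L(A)) x| by
   |H| ((|A| + |B|)^2 - |A|^2) / b^2, which the hypothesis on |B| makes
   smaller than 1. *)
Require Import Defs.
From mathcomp Require Import all_boot all_order all_algebra.
From mathcomp Require Import boolp classical_sets reals complex.
From mathcomp Require Import ring lra.

Set Implicit Arguments.
Unset Strict Implicit.
Unset Printing Implicit Defensive.

Import Order.TTheory GRing.Theory Num.Theory.

Local Open Scope classical_set_scope.
Local Open Scope ring_scope.
Local Open Scope complex_scope.
Local Open Scope sesquilinear_scope.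

(** [eigenvalue] concerns row vectors. A singular [M - z%:M] has a singular transpose, and
    transposing a row vector in the kernel of that transpose gives the column eigenvector. *)
Lemma eigenvalue_colP (F : fieldType) (n : nat) (M : 'M[F]_n) (z : F) :
  eigenvalue M z -> exists2 x : 'cV[F]_n, M *m x = z *: x & x != 0.
Proof.
move=> Mz.
have: kermx (M - z%:M)^T != 0.
  rewrite kermx_eq0 /row_free mxrank_tr -/(row_free _) -kermx_eq0.
  exact: Mz.
case/rowV0Pn => v /sub_kermxP /(congr1 trmx); rewrite trmx_mul trmxK trmx0.
rewrite mulmxBl mul_scalar_mx => /eqP; rewrite subr_eq0 => /eqP Mv v0.
exists v^T => //; apply: contraNneq v0 => /(congr1 trmx).
by rewrite trmxK trmx0 => ->.
Qed.

Lemma euclidean_norm_ge0 (R : realType) (n : nat) (x : 'cV[R[i]]_n) :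
  0 <= euclidean_norm x.
Proof. exact: sqrtr_ge0. Qed.

Lemma dotmx_euclidean_norm (R : realType) (n : nat) (x : 'cV[R[i]]_n) :
  (x ^t* *m x) 0 0 = (euclidean_norm x ^+ 2)%:C.
Proof.
rewrite sqr_sqrtr; last by apply: sumr_ge0 => i _; rewrite addr_ge0 ?sqr_ge0.
rewrite mxE rmorph_sum; apply: eq_bigr => i _.
by rewrite !mxE /= add_Re2_Im2 normCKC.
Qed.

Lemma euclidean_normZ (R : realType) (n : nat) (c : R) (x : 'cV[R[i]]_n) :
  euclidean_norm (c%:C *: x) = `|c| * euclidean_norm x.
Proof.
rewrite /euclidean_norm -sqrtr_sqr -sqrtrM ?sqr_ge0// mulr_sumr.
by congr Num.sqrt; apply: eq_bigr => i _; rewrite mxE; case: (x i 0) => r s /=;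
  ring.
Qed.

Lemma euclidean_norm0 (R : realType) (n : nat) :
  euclidean_norm (0 : 'cV[R[i]]_n) = 0.
Proof.
rewrite /euclidean_norm big1 ?sqrtr0// => i _.
by rewrite mxE /= expr0n addr0.
Qed.

Lemma euclidean_norm_gt0 (R : realType) (n : nat) (x : 'cV[R[i]]_n) :
  x != 0 -> 0 < euclidean_norm x.
Proof.
move=> x0; rewrite lt_def euclidean_norm_ge0 andbT.
have xt0 : x ^t* != 0.
  apply: contraNneq x0 => /(congr1 (fun y => y ^t*)).
  by rewrite trmxCK linear0 map_mx0 => ->.
have := dotmx_is_dotmx xt0.
rewrite dotmxE trmxCK dotmx_euclidean_norm; apply: contraTneq => ->.
by rewrite expr0n ltxx.
Qed.

(** The inner product [dotmx] lives on row vectors, so its Cauchy-Schwarz inequality is applied to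
    [x ^t*] and [y ^t*]; it compares squares, hence the initial squaring. *)
Lemma dotmx_cauchy_schwarz (R : realType) (n : nat) (x y : 'cV[R[i]]_n) :
  `|(x ^t* *m y) 0 0| <= (euclidean_norm x * euclidean_norm y)%:C.
Proof.
have xy0 : 0 <= (euclidean_norm x * euclidean_norm y)%:C.
  by rewrite lecR mulr_ge0 ?euclidean_norm_ge0.
rewrite -(ler_pXn2r (n := 2)) ?nnegrE//.
have -> : (euclidean_norm x * euclidean_norm y)%:C ^+ 2 =
    (x ^t* *m x) 0 0 * (y ^t* *m y) 0 0.
  by rewrite !dotmx_euclidean_norm; ring.
have := (CauchySchwarz (@dotmx _ n) (x ^t* ) (y ^t* )).1.
by rewrite /= !dotmxE !trmxCK.
Qed.

(** Makes the supremum in [spectral_norm] genuine, since [sup] of an unbounded set is only a default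
    value. The witness [K] is the Frobenius norm, by Cauchy-Schwarz on each row. *)
Lemma euclidean_norm_mulmx_bounded (R : realType) (m : nat) (M : 'M[R[i]]_m) :
  exists2 K : R, 0 <= K &
    forall x, euclidean_norm (M *m x) <= K * euclidean_norm x.
Proof.
pose s := \sum_i euclidean_norm ((row i M) ^t* ) ^+ 2.
have s0 : 0 <= s by apply: sumr_ge0 => i _; rewrite sqr_ge0.
exists (Num.sqrt s) => [|x]; first exact: sqrtr_ge0.
rewrite -[euclidean_norm x]ger0_norm ?euclidean_norm_ge0// -sqrtr_sqr -sqrtrM//.
rewrite ler_sqrt; last by rewrite mulr_ge0 ?sqr_ge0.
rewrite /s mulr_suml; apply: ler_sum => i _.
rewrite -lecR add_Re2_Im2 -exprMn rmorphXn /= lerXn2r ?nnegrE//.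
  by rewrite lecR mulr_ge0 ?euclidean_norm_ge0.
have := dotmx_cauchy_schwarz ((row i M) ^t* ) x.
by rewrite trmxCK -row_mul mxE.
Qed.

Lemma euclidean_norm_mulmx_le (R : realType) (m : nat) (M : 'M[R[i]]_m)
    (x : 'cV[R[i]]_m) :
  euclidean_norm (M *m x) <= spectral_norm M * euclidean_norm x.
Proof.
have [K K0 MK] := euclidean_norm_mulmx_bounded M.
have [->|x0] := eqVneq x 0.
  by rewrite mulmx0 euclidean_norm0 mulr0.
have xgt0 := euclidean_norm_gt0 x0.
(* Rescaling [x] to a unit vector yields a member of the set under the supremum. *)
rewrite -ler_pdivrMr// mulrC -[_^-1]ger0_norm ?invr_ge0 ?euclidean_norm_ge0//.
rewrite -euclidean_normZ scalemxAr.
apply: ub_le_sup; last first.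
  eexists; last reflexivity.
  rewrite /= euclidean_normZ ger0_norm ?invr_ge0 ?euclidean_norm_ge0//.
  by rewrite mulVf ?gt_eqF.
exists K => _ [y /= y1 <-].
by apply: le_trans (MK y) _; rewrite ler_piMr.
Qed.

Lemma spectral_norm_ge0 (R : realType) (m : nat) (M : 'M[R[i]]_m) :
  0 <= spectral_norm M.
Proof.
have [K K0 MK] := euclidean_norm_mulmx_bounded M.
apply: le_trans (euclidean_norm_ge0 (M *m 0)) _.
apply: ub_le_sup.
  by exists K => _ [y /= y1 <-]; apply: le_trans (MK y) _; rewrite ler_piMr.
by exists 0 => //=; rewrite euclidean_norm0 ler01.
Qed.

Lemma sesqui_spectral_norm_le (R : realType) (m : nat) (M : 'M[R[i]]_m)
    (x y : 'cV[R[i]]_m) :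
  `|(x ^t* *m M *m y) 0 0| <=
  (spectral_norm M * (euclidean_norm x * euclidean_norm y))%:C.
Proof.
rewrite -mulmxA; apply: le_trans (dotmx_cauchy_schwarz _ _) _.
by rewrite lecR mulrCA ler_wpM2l ?euclidean_norm_ge0 ?euclidean_norm_mulmx_le.
Qed.

(** The hypothesis squares to [(p + q)^2 < p^2 + b^2 / h], so [2 p q + q^2] stays below [b^2 / h].
    For [h = 0] the conclusion reads [0 < 1]. *)
Lemma perturbation_size_lt (R : realType) (b h p q : R) :
  0 < b -> 0 <= h -> 0 <= p -> 0 <= q ->
  q < Num.sqrt (p ^+ 2 + b ^+ 2 / h) - p ->
  h * (q * p + p * q + q * q) / b ^+ 2 < 1.
Proof.
move=> b0 h0 p0 q0 hq.
have bn0 : 0 < b ^+ 2 by rewrite exprn_gt0.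
have [hE|hn0] := eqVneq h 0; first by rewrite hE !mul0r.
have hgt0 : 0 < h by rewrite lt_def hn0.
have : (p + q) ^+ 2 < p ^+ 2 + b ^+ 2 / h.
  rewrite -ltr_sqrt; last by rewrite ltr_wpDl ?sqr_ge0 ?divr_gt0.
  by rewrite sqrtr_sqr ger0_norm ?addr_ge0//; lra.
rewrite ltr_pdivrMr// mul1r => hpq.
have : q * p + p * q + q * q < b ^+ 2 / h by lra.
by rewrite ltr_pdivlMr// mulrC.
Qed.

(** The sum of [z ^+ 2] and its conjugate is twice [Re^2 - Im^2]. With [c] and [d] the two
    coefficients on the right, [c + 2 d = 1 / a^2] and [c - 2 d = 1 / b^2]. *)
Lemma ellipse_form (R : realType) (a b : R) (z : R[i]) :
  a != 0 -> b != 0 ->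
  (complex.Re z ^+ 2 / a ^+ 2 + complex.Im z ^+ 2 / b ^+ 2)%:C =
  (1 / (2 * a ^+ 2) + 1 / (2 * b ^+ 2))%:C * (z^* * z)
  + (1 / (4 * a ^+ 2) - 1 / (4 * b ^+ 2))%:C * (z ^+ 2 + z^* ^+ 2).
Proof.
move=> a0 b0; case: z => r s; apply/eqP; rewrite eq_complex /= !expr2 /=.
apply/andP; split; apply/eqP; field; exact/andP.
Qed.

Theorem corollary1 (R : realType) (n : nat) (a b : R) (A H B : 'M[R[i]]_n)
  (hb : 0 < b) (hab : b < a)
  (hA : spectrum A `<=` ellipse_interior a b)
  (hH : posdefmx H)
  (hHeq : H - (1 / (2 * a ^+ 2) + 1 / (2 * b ^+ 2))%:C *: (A ^t* *m H *m A)
            - (1 / (4 * a ^+ 2) - 1 / (4 * b ^+ 2))%:C *: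
                (H *m (A ^+ 2) + (A ^t*) ^+ 2 *m H)
          = 1%:M)
  (hB : spectral_norm B <
        Num.sqrt (spectral_norm A ^+ 2 + b ^+ 2 / spectral_norm H)
          - spectral_norm A) :
  spectrum (A + B) `<=` ellipse_interior a b.
Proof.
move=> z /eigenvalue_colP[x zx x0].
have ha : 0 < a by exact: lt_trans hab.
rewrite /ellipse_interior /=.
have /(_ z) := ellipse_form _ (lt0r_neq0 ha) (lt0r_neq0 hb).
move: hHeq; set al := 1 / (2 * a ^+ 2) + _; set be := 1 / (4 * a ^+ 2) - _.
set E := complex.Re z ^+ 2 / _ + _ => {}hHeq hE.
(* As [be <= 0], the triangle inequality will produce the factor [al + 2 |be|], which is this value;
   this is where the [b^2] in the bound on [B] comes from. *)
have albe : al - 2 * be = (b ^+ 2)^-1.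
  by rewrite /al /be; field; rewrite !lt0r_neq0.
have al0 : 0 <= al by rewrite addr_ge0 ?divr_ge0 ?mulr_ge0 ?ltW.
have be0 : be <= 0.
  rewrite subr_le0 !div1r lef_pV2 ?posrE ?mulr_gt0 ?exprn_gt0//.
  by rewrite ler_pM2l// lerXn2r// ?nnegrE ltW.
pose q (u v : 'cV[R[i]]_n) := (u ^t* *m H *m v) 0 0.
have qDl u v w : q (u + v) w = q u w + q v w.
  by rewrite /q linearD /= map_mxD !mulmxDl mxE.
have qDr u v w : q w (u + v) = q w u + q w v by rewrite /q mulmxDr mxE.
have qZl c u v : q (c *: u) v = c^* * q u v.
  by rewrite /q linearZ /= map_mxZ -!scalemxAl mxE.
have qZr c u v : q u (c *: v) = c * q u v by rewrite /q -scalemxAr mxE.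
set N := euclidean_norm x.
have N0 : 0 < N := euclidean_norm_gt0 x0.
(* [(A + B) x = y + w] and [(A + B)^2 x = A y + u], with all terms containing [B] gathered in [w]
   and [u]. *)
pose y := A *m x; pose w := B *m x; pose u := A *m w + B *m y + B *m w.
have yw : y + w = z *: x by rewrite -mulmxDl.
have Ayu : A *m y + u = z *: (z *: x).
  by rewrite -[in RHS]zx scalemxAr -yw mulmxDl !mulmxDr /u !addrA.
(* The equation for [H] tested on [x], which is not normalised: [N ^+ 2] replaces the 1 of the unit
   case. *)
have lyap : q x x - al%:C * q y y - be%:C * (q x (A *m y) + q (A *m y) x)
    = (N ^+ 2)%:C.
  pose f M := (x ^t* *m M *m x) 0 0.
  have fB M M' : f (M - M') = f M - f M' by rewrite /f mulmxBr mulmxBl !mxE.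
  have fD M M' : f (M + M') = f M + f M' by rewrite /f mulmxDr mulmxDl !mxE.
  have fZ c M : f (c *: M) = c * f M.
    by rewrite /f -scalemxAr -scalemxAl mxE.
  rewrite -dotmx_euclidean_norm -[x ^t* in RHS]mulmx1 -hHeq -/(f _).
  rewrite !(fB, fZ, fD); congr (_ - _ * _ - _ * (_ + _)).
  - by rewrite /q /y /f trmx_mul map_mxM !mulmxA.
  - by rewrite /q /y /f expr2 -[A * A]/(A *m A) !mulmxA.
  - rewrite /q /y /f expr2 -[A ^t* * A ^t*]/(A ^t* *m A ^t* ).
    by rewrite !trmx_mul !map_mxM !mulmxA.
(* [D] is [x' (L(A) - L(A + B)) x], so [pE] evaluates [x' L(A + B) x] in two ways. *)
pose D := al%:C * (q y w + q w y + q w w) + be%:C * (q x u + q u x).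
have pE : q x x * (1 - E%:C) = (N ^+ 2)%:C - D.
  have zz : z^* * z * q x x = q y y + (q y w + q w y + q w w).
    have : q (y + w) (y + w) = q (z *: x) (z *: x) by rewrite yw.
    rewrite !(qDl, qDr, qZl, qZr) => h.
    by rewrite -mulrA -h !addrA.
  have z2 : z ^+ 2 * q x x = q x (A *m y) + q x u.
    by rewrite -qDr Ayu !qZr; ring.
  have zb2 : z^* ^+ 2 * q x x = q (A *m y) x + q u x.
    by rewrite -qDl Ayu !qZl; ring.
  transitivity (q x x - al%:C * (z^* * z * q x x)
      - be%:C * (z ^+ 2 * q x x + z^* ^+ 2 * q x x)).
    by rewrite hE; ring.
  rewrite zz z2 zb2 -lyap /D.
  (* Abstracting the values of [q] keeps [ring] from comparing their bodies. *)
  move: (q y y) (q x x) (_ + q w w) (q x u) (q u x) (q x _) (q _ x) => *.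
  by ring.
set h := spectral_norm H; set kA := spectral_norm A; set kB := spectral_norm B.
have hs : h * (kB * kA + kA * kB + kB * kB) / b ^+ 2 < 1.
  by apply: perturbation_size_lt => //; exact: spectral_norm_ge0.
have qb v v' c c' : euclidean_norm v <= c * N -> euclidean_norm v' <= c' * N ->
    `|q v v'| <= (h * (c * c') * N ^+ 2)%:C.
  move=> vc vc'; apply: le_trans (sesqui_spectral_norm_le _ _ _) _.
  rewrite lecR -mulrA ler_wpM2l ?spectral_norm_ge0//.
  by rewrite expr2 mulrACA ler_pM ?euclidean_norm_ge0.
have normM (M : 'M[R[i]]_n) v c : euclidean_norm v <= c * N ->
    euclidean_norm (M *m v) <= spectral_norm M * c * N.
  move=> vc; apply: le_trans (euclidean_norm_mulmx_le _ _) _.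
  by rewrite -mulrA ler_wpM2l ?spectral_norm_ge0.
have xN : euclidean_norm x <= 1 * N by rewrite mul1r.
have normA v c : euclidean_norm v <= c * N ->
    euclidean_norm (A *m v) <= kA * c * N by exact: normM.
have normB v c : euclidean_norm v <= c * N ->
    euclidean_norm (B *m v) <= kB * c * N by exact: normM.
have yN : euclidean_norm y <= kA * N by have := normA _ _ xN; rewrite mulr1.
have wN : euclidean_norm w <= kB * N by have := normB _ _ xN; rewrite mulr1.
have p0 : 0 < q x x := hH.2 x x0.
clearbody h kA kB N.
(* The quadratic remainder in [y], [w] and both pairings of [x] with [u] split into three terms with
   the same factors [kB kA], [kA kB], [kB kB], so one bound [S] serves all of them. *)
have [S SE] : {S | S = h * (kB * kA + kA * kB + kB * kB) * N ^+ 2} by eexists.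
have SN : S / b ^+ 2 < N ^+ 2.
  by rewrite SE mulrAC -[ltRHS]mul1r ltr_pM2r ?exprn_gt0.
have tri (c1 c2 c3 : R[i]) :
    `|c1| <= (h * (kB * kA) * N ^+ 2)%:C ->
    `|c2| <= (h * (kA * kB) * N ^+ 2)%:C ->
    `|c3| <= (h * (kB * kB) * N ^+ 2)%:C -> `|c1 + c2 + c3| <= S%:C.
  move=> h1 h2 h3; rewrite SE !mulrDr !mulrDl !rmorphD.
  apply: (le_trans (ler_normD _ _)); apply: lerD h3.
  by apply: (le_trans (ler_normD _ _)); apply: lerD.
have T1 : `|q y w + q w y + q w w| <= S%:C.
  by rewrite (addrC (q y w)); apply: tri; exact: qb.
(* The vector [x] enters with factor 1, inserted to match the shape of [qb]. *)
have T2 : `|q x u| <= S%:C.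
  rewrite /u !qDr; apply: tri; rewrite -[X in h * X]mul1r; apply: qb => //.
  - by rewrite (mulrC kB); exact: normA.
  - by rewrite (mulrC kA); exact: normB.
  - exact: normB.
have T3 : `|q u x| <= S%:C.
  rewrite /u !qDl; apply: tri; rewrite -[X in h * X]mulr1; apply: qb => //.
  - by rewrite (mulrC kB); exact: normA.
  - by rewrite (mulrC kA); exact: normB.
  - exact: normB.
(* The three bounds combine to [(al - 2 be) S = S / b^2]. *)
have DN : `|D| < (N ^+ 2)%:C.
  apply: (@le_lt_trans _ _ (S / b ^+ 2)%:C); last by rewrite ltcR.
  have -> : (S / b ^+ 2)%:C = al%:C * S%:C + (- be)%:C * (S%:C + S%:C).
    by rewrite -albe -!rmorphD -!rmorphM -rmorphD; congr _%:C; ring.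
  rewrite /D; apply: (le_trans (ler_normD _ _)); rewrite !normrM.
  have alC : 0 <= al%:C :> R[i] by rewrite lecR.
  have beC : 0 <= (- be)%:C :> R[i] by rewrite lecR oppr_ge0.
  rewrite (ger0_norm alC) -(normrN be%:C) -rmorphN (ger0_norm beC).
  apply: lerD; apply: ler_wpM2l => //.
  by apply: (le_trans (ler_normD _ _)); apply: lerD.
clearbody D.
(* If [E >= 1], then [q x x], a positive real [P], forces [D = N^2 + P (E - 1) >= N^2], against
   [DN]. *)
rewrite ltNge; apply/negP => E1; case/negP: (lt_geF DN).
have /complex_realP[P pP] : q x x \is Num.real by exact: gtr0_real.
rewrite pP ltcR in p0; rewrite pP in pE.
have -> : D = (N ^+ 2 + P * (E - 1))%:C.
  by rewrite -[LHS](subKr (N ^+ 2)%:C) -pE; clearbody E; ring.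
have PE : 0 <= P * (E - 1) by rewrite mulr_ge0 ?subr_ge0// ltW.
have ND : 0 <= (N ^+ 2 + P * (E - 1))%:C by rewrite lecR addr_ge0 ?sqr_ge0.
by rewrite (ger0_norm ND) lecR lerDl.
Qed.
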